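(* Let $a\in\mathbb{R}$. For every integer $N\ge 0$ and all $x\in\mathbb{R}$, $$Q_{N}^{(0,-a)}(x)=N!\sum_{n=0}^{[N/2]}\binom{-a-1}{n}x^{2n}\,C^{(n+a+1)}_{N-2n}(-x),$$ where $[N/2]$ denotes the integer part of $N/2$ and $C_l^{(\lambda)}$ are the Gegenbauer polynomials.
   Context: Throughout $x$ is a real variable, $\alpha,a$ are real parameters, $\sigma(x)=1+x^2$, and $\cot^{-1}:\mathbb{R}\to(0,\pi)$ is the smooth branch, so that $\frac{d}{dx}\cot^{-1}x=-1/\sigma(x)$. For integers $l\ge 0$ put $w_l(x)=\sigma(x)^{-(l+a+1)}e^{-\alpha\cot^{-1}x}=\sigma(x)^{-l}w_0(x)$. Define $P_l^{(a,\alpha)}(x)=\frac{1}{w_l(x)}\frac{d^l}{dx^l}[w_l(x)\sigma(x)^l]=\frac{\sigma(x)^l}{w_0(x)}\frac{d^l w_0(x)}{dx^l}$. The complementary (Romanovski) polynomials $Q_\nu^{(\alpha,-a)}$, with $Q_0^{(\alpha,-a)}\equiv 1$, are defined by the Rodrigues representation $P_l^{(a,\alpha)}(x)=\frac{1}{w_l(x)}\frac{d^{l-\nu}}{dx^{l-\nu}}[\sigma(x)^{l-\nu}w_l(x)Q_\nu^{(\alpha,-a)}(x)]$ for all integers $0\le\nu\le l$ (the case $l=\nu$ reads $Q_\nu^{(\alpha,-a)}=P_\nu^{(a,\alpha)}$). $Q_N^{(0,-a)}$ is the case $\alpha=0$. The Gegenbauer polynomials are defined, for every real $\lambda$, by $(1-2xy+y^2)^{-\lambda}=\sum_{l=0}^{\infty}C_l^{(\lambda)}(x)y^l$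 (power series in $y$ near $0$). $\binom{c}{n}=c(c-1)\cdots(c-n+1)/n!$ is the generalized binomial coefficient. *)

(* Defs.v *)
From Stdlib Require Export Arith Factorial Reals.
From Coquelicot Require Export Coquelicot.
From Stdlib Require Import Lra Lia Psatz.
Open Scope R_scope.

Definition sigma (x : R) : R := 1 + x ^ 2.

(* The smooth branch of the inverse cotangent, with values in (0, PI). *)
Definition arccot (x : R) : R := PI / 2 - atan x.

Definition weight (a alpha : R) (l : nat) (x : R) : R :=
  Rpower (sigma x) (- (INR l + a + 1)) * exp (- alpha * arccot x).

Definition polyP (a alpha : R) (l : nat) (x : R) : R :=
  / weight a alpha l x
  * Derive_n (fun t => weight a alpha l t * sigma t ^ l) l x.

(* [is_romanovski a alpha Q] : [Q nu] is the complementary polynomial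
   Q_nu^{(alpha, -a)}; the case l = nu of the second clause determines Q. *)
Definition is_romanovski (a alpha : R) (Q : nat -> R -> R) : Prop :=
  (forall x, Q 0%nat x = 1) /\
  (forall (nu l : nat) (x : R), (nu <= l)%nat ->
     polyP a alpha l x =
     / weight a alpha l x
     * Derive_n
         (fun t => sigma t ^ (l - nu) * weight a alpha l t * Q nu t)
         (l - nu) x).

(* [is_gegenbauer lambda C] : [C l x] is C_l^(lambda)(x). *)
Definition is_gegenbauer (lambda : R) (C : nat -> R -> R) : Prop :=
  forall x : R,
    locally 0 (fun y : R =>
      is_pseries (fun l => C l x) y
        (Rpower (1 - 2 * x * y + y ^ 2) (- lambda))).

Fixpoint falling (c : R) (n : nat) : R :=
  match n with
  | O => 1
  | S m => falling c m * (c - INR m)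
  end.

Definition gbinom (c : R) (n : nat) : R := falling c n / INR (fact n).

Lemma arccot_bound (x : R) : 0 < arccot x < PI.
Proof. unfold arccot. generalize (atan_bound x). lra. Qed.

Lemma is_derive_arccot (x : R) : is_derive arccot x (- 1 / sigma x).
Proof.
assert (0 < 1 + x ^ 2) by nra.
unfold arccot, sigma.
evar_last.
- apply @is_derive_minus; [apply is_derive_const|].
  apply is_derive_Reals, derivable_pt_lim_atan.
- unfold minus, plus, opp, zero, Rsqr; simpl. field. nra.
Qed.

Lemma sigma_gt0 (x : R) : 0 < sigma x.
Proof. unfold sigma. nra. Qed.

Lemma weight_gt0 (a alpha : R) (l : nat) (x : R) : 0 < weight a alpha l x.
Proof. apply Rmult_lt_0_compat; apply exp_pos. Qed.

Lemma weightE (a alpha : R) (l : nat) (x : R) :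
  weight a alpha l x * sigma x ^ l = weight a alpha 0 x.
Proof.
unfold weight.
rewrite <- (Rpower_pow l (sigma x)) by apply sigma_gt0.
rewrite Rmult_comm, <- Rmult_assoc, <- Rpower_plus.
f_equal. f_equal. simpl. ring.
Qed.

Lemma polyPE (a alpha : R) (l : nat) (x : R) :
  polyP a alpha l x =
  sigma x ^ l / weight a alpha 0 x * Derive_n (weight a alpha 0) l x.
Proof.
unfold polyP.
rewrite (Derive_n_ext _ (weight a alpha 0)) by (intro; apply weightE).
rewrite <- (weightE a alpha l x).
generalize (weight_gt0 a alpha l x) (pow_lt _ l (sigma_gt0 x)); intros.
field. lra.
Qed.

Lemma is_romanovski_exists (a alpha : R) : is_romanovski a alpha (polyP a alpha).
Proof.
split.
- intro x. rewrite polyPE. simpl.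
  generalize (weight_gt0 a alpha 0 x); intro. field. lra.
- intros nu l x Hl. unfold polyP at 1. f_equal.
  rewrite (Derive_n_ext _ (weight a alpha 0)) by (intro; apply weightE).
  symmetry.
  rewrite (Derive_n_ext _ (Derive_n (weight a alpha 0) nu)).
  + rewrite Derive_n_comp. f_equal. lia.
  + intro t. rewrite polyPE.
    rewrite <- (weightE a alpha l t).
    generalize (weight_gt0 a alpha l t) (pow_lt _ l (sigma_gt0 t)); intros.
    replace (sigma t ^ l) with (sigma t ^ (l - nu) * sigma t ^ nu) in *
      by (rewrite <- pow_add; f_equal; lia).
    field. split; nra.
Qed.

Lemma is_romanovski_unique (a alpha : R) (Q : nat -> R -> R) :
  is_romanovski a alpha Q -> forall nu x, Q nu x = polyP a alpha nu x.
Proof.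
intros [_ H] nu x.
rewrite (H nu nu x (le_n nu)), Nat.sub_diag. simpl.
generalize (weight_gt0 a alpha nu x); intro. field. lra.
Qed.

(* Coefficients (c_n, c_(n+1)) of the power series solution of
   (1 - 2 x y + y^2) f' = 2 lambda (x - y) f with f 0 = 1. *)
Fixpoint gegenbauer_pair (lambda x : R) (n : nat) : R * R :=
  match n with
  | O => (1, 2 * lambda * x)
  | S m => let (c, d) := gegenbauer_pair lambda x m in
      (d, (2 * x * (INR m + 1 + lambda) * d - (INR m + 2 * lambda) * c)
          / (INR m + 2))
  end.

Definition gegenbauer_rec (lambda : R) (n : nat) (x : R) : R :=
  fst (gegenbauer_pair lambda x n).

Lemma gegenbauer_recSS (lambda : R) (n : nat) (x : R) :
  (INR n + 2) * gegenbauer_rec lambda (S (S n)) x =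
  2 * x * (INR n + 1 + lambda) * gegenbauer_rec lambda (S n) x
  - (INR n + 2 * lambda) * gegenbauer_rec lambda n x.
Proof.
unfold gegenbauer_rec; simpl.
destruct (gegenbauer_pair lambda x n) as [c d]; simpl.
generalize (pos_INR n); intro. field. lra.
Qed.

Lemma gegenbauer_rec_bound (lambda x : R) (n : nat) :
  Rabs (gegenbauer_rec lambda n x)
  <= (2 + 2 * Rabs lambda + 2 * Rabs x * (1 + Rabs lambda)) ^ n.
Proof.
set (M := 2 + 2 * Rabs lambda + 2 * Rabs x * (1 + Rabs lambda)).
set (A := 2 * Rabs x * (1 + Rabs lambda)).
set (B := 1 + 2 * Rabs lambda).
generalize (Rabs_pos lambda) (Rabs_pos x); intros Hl Hx.
assert (HA : 0 <= A) by (unfold A; nra).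
assert (HM : M = 1 + A + B) by (unfold M, A, B; ring).
assert (HB : 1 <= B) by (unfold B; lra).
cut (Rabs (gegenbauer_rec lambda n x) <= M ^ n
     /\ Rabs (gegenbauer_rec lambda (S n) x) <= M ^ S n).
{ tauto. }
induction n as [|n [IH0 IH1]].
- unfold gegenbauer_rec; simpl. rewrite Rabs_R1. split; [lra|].
  rewrite !Rabs_mult, (Rabs_pos_eq 2) by lra. unfold M; nra.
- split; [exact IH1|].
  generalize (pos_INR n); intro Hn.
  apply Rmult_le_reg_l with (INR n + 2); [lra|].
  rewrite <- (Rabs_pos_eq (INR n + 2)) at 1 by lra.
  rewrite <- Rabs_mult, gegenbauer_recSS.
  set (c := gegenbauer_rec lambda n x) in *.
  set (d := gegenbauer_rec lambda (S n) x) in *.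
  assert (H1 : Rabs (2 * x * (INR n + 1 + lambda) * d) <= (INR n + 2) * A * M ^ S n).
  { rewrite !Rabs_mult, (Rabs_pos_eq 2) by lra.
    apply Rmult_le_compat; try apply Rabs_pos; try exact IH1.
    { repeat apply Rmult_le_pos; try apply Rabs_pos; lra. }
    assert (Rabs (INR n + 1 + lambda) <= INR n + 1 + Rabs lambda).
    { eapply Rle_trans; [apply Rabs_triang|]. rewrite (Rabs_pos_eq (INR n + 1)); lra. }
    apply Rle_trans with (2 * Rabs x * ((INR n + 2) * (1 + Rabs lambda)));
      [|unfold A; right; ring].
    apply Rmult_le_compat_l; [lra|]. nra. }
  assert (H2 : Rabs ((INR n + 2 * lambda) * c) <= (INR n + 2) * B * M ^ n).
  { rewrite Rabs_mult.
    apply Rmult_le_compat; try apply Rabs_pos; try exact IH0.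
    eapply Rle_trans; [apply Rabs_triang|].
    rewrite Rabs_mult, (Rabs_pos_eq 2), (Rabs_pos_eq (INR n)) by lra. unfold B. nra. }
  assert (H3 : 0 < M ^ n) by (apply pow_lt; lra).
  assert (H4 : M ^ n <= M ^ S n) by (simpl; nra).
  unfold Rminus. eapply Rle_trans; [apply Rabs_triang|]. rewrite Rabs_Ropp.
  change (M ^ S (S n)) with (M * M ^ S n).
  apply Rle_trans with ((INR n + 2) * ((A + B) * M ^ S n)).
  + apply Rle_trans with ((INR n + 2) * A * M ^ S n + (INR n + 2) * B * M ^ S n);
      [|right; ring].
    apply Rplus_le_compat; [exact H1|].
    eapply Rle_trans; [exact H2|].
    apply Rmult_le_compat_l; [nra|exact H4].
  + apply Rmult_le_compat_l; [lra|]. apply Rmult_le_compat_r; [lra|]. lra.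
Qed.

Lemma is_gegenbauer_exists (lambda : R) :
  is_gegenbauer lambda (gegenbauer_rec lambda).
Proof.
intro x.
set (c := fun l => gegenbauer_rec lambda l x).
set (M := 2 + 2 * Rabs lambda + 2 * Rabs x * (1 + Rabs lambda)).
generalize (Rabs_pos lambda) (Rabs_pos x); intros Hl Hx.
assert (HM : 1 + 2 * Rabs x < M) by (unfold M; nra).
assert (HMp : 0 < / M) by (apply Rinv_0_lt_compat; lra).
assert (Hcv : Rbar_le (/ M) (CV_radius c)).
{ apply (proj1 (CV_radius_bounded c)). exists 1. intro n.
  rewrite Rabs_mult, <- RPow_abs, (Rabs_pos_eq (/ M)) by lra.
  apply Rle_trans with (M ^ n * (/ M) ^ n).
  - apply Rmult_le_compat_r; [apply pow_le; lra|]. apply gegenbauer_rec_bound.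
  - rewrite <- Rpow_mult_distr, Rinv_r, pow1; lra. }
assert (Hin : forall y, Rabs y < / M -> Rbar_lt (Rabs y) (CV_radius c)).
{ intros y Hy. apply Rbar_lt_le_trans with (/ M); [exact Hy|exact Hcv]. }
assert (Hpos : forall y, Rabs y < / M -> 0 < 1 - 2 * x * y + y ^ 2).
{ intros y Hy.
  assert (Rabs y * M < 1).
  { apply Rmult_lt_reg_r with (/ M); [exact HMp|].
    rewrite Rmult_assoc, Rinv_r, Rmult_1_r, Rmult_1_l; lra. }
  assert (x * y <= Rabs x * Rabs y) by (rewrite <- Rabs_mult; apply Rle_abs).
  generalize (Rabs_pos y); intro. nra. }
assert (Hode : forall y, Rabs y < / M ->
  (1 - 2 * x * y + y ^ 2) * PSeries (PS_derive c) y
  = 2 * lambda * (x - y) * PSeries c y).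
{ intros y Hy.
  generalize (PSeries_correct _ _ (CV_radius_inside _ _ (Hin y Hy))).
  generalize (PSeries_correct _ _ (ex_pseries_derive _ _ (Hin y Hy))).
  generalize (PSeries (PS_derive c) y) (PSeries c y). intros g f Hg Hf.
  assert (Hmul : forall (k : R) u s, is_pseries u y s ->
            is_pseries (PS_scal k u : nat -> R) y (k * s : R)).
  { intros k u s Hu. apply (is_pseries_scal k u y s); [apply Rmult_comm|exact Hu]. }
  assert (Hg1 := is_pseries_incr_1 _ _ _ Hg).
  assert (Hg2 := is_pseries_incr_1 _ _ _ Hg1).
  assert (Hf1 := is_pseries_incr_1 _ _ _ Hf).
  assert (HR := is_pseries_plus _ _ _ _ _
    (is_pseries_plus _ _ _ _ _ (Hmul (2 * x) _ _ Hg1) (Hmul (- 1) _ _ Hg2))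
    (is_pseries_plus _ _ _ _ _ (Hmul (2 * lambda * x) _ _ Hf)
                               (Hmul (- 2 * lambda) _ _ Hf1))).
  assert (HE : is_pseries (PS_derive c) y
    (plus (plus (2 * x * scal y g) (-1 * scal y (scal y g)))
       (plus (2 * lambda * x * f) (-2 * lambda * scal y f)))).
  { eapply is_pseries_ext; [|exact HR].
    intro n. unfold PS_plus, PS_scal, PS_incr_1, PS_derive, plus, scal, zero, c.
    destruct n as [|[|n]].
    - unfold gegenbauer_rec. simpl. unfold mult; simpl. ring.
    - generalize (gegenbauer_recSS lambda 0 x). simpl INR. simpl. unfold mult; simpl.
      lra.
    - generalize (gegenbauer_recSS lambda (S n) x).
      rewrite !S_INR. simpl. unfold mult; simpl. lra. }
  assert (HU := is_pseries_unique _ _ _ HE).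
  rewrite (is_pseries_unique _ _ _ Hg) in HU.
  unfold plus, scal in HU; simpl in HU; unfold mult in HU; simpl in HU.
  lra. }
set (h := fun y => PSeries c y * Rpower (1 - 2 * x * y + y ^ 2) lambda).
assert (Hd : forall y, Rabs y < / M -> is_derive h y 0).
{ intros y Hy. unfold h, Rpower.
  assert (Hp := Hpos y Hy).
  evar_last.
  - apply @is_derive_mult; [apply is_derive_PSeries, Hin, Hy| |intros; apply Rmult_comm].
    instantiate (1 := exp (lambda * ln (1 - 2 * x * y + y ^ 2))
                      * (lambda * ((- 2 * x + 2 * y) / (1 - 2 * x * y + y ^ 2)))).
    auto_derive; [exact Hp|].
    simpl. simpl in Hp.
    change (1 + - (2 * x * y) + y * (y * 1)) with (1 - 2 * x * y + y * (y * 1)).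
    generalize (exp (lambda * ln (1 - 2 * x * y + y * (y * 1)))); intro.
    field. lra.
  - assert (Ho := Hode y Hy).
    assert (Hgo : PSeries (PS_derive c) y
      = 2 * lambda * (x - y) * PSeries c y / (1 - 2 * x * y + y ^ 2)).
    { rewrite <- Ho. field. lra. }
    rewrite Hgo. unfold plus, mult; simpl. simpl in Hp.
    generalize (exp (lambda * ln (1 - 2 * x * y + y * (y * 1)))); intro.
    field. lra. }
assert (Hh0 : h 0 = 1).
{ unfold h. rewrite PSeries_0.
  replace (1 - 2 * x * 0 + 0 ^ 2) with 1 by ring.
  unfold Rpower. rewrite ln_1, Rmult_0_r, exp_0. unfold c, gegenbauer_rec; simpl. ring. }
assert (Hh : forall y, Rabs y < / M -> h y = 1).
{ intros y Hy. rewrite <- Hh0.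
  destruct (Rtotal_order y 0) as [H|[H|H]].
  - apply (@eq_is_derive R_NormedModule); [|exact H].
    intros t Ht. apply Hd. rewrite Rabs_left1 in * by lra. lra.
  - now rewrite H.
  - symmetry. apply (@eq_is_derive R_NormedModule); [|exact H].
    intros t Ht. apply Hd. rewrite Rabs_pos_eq in * by lra. lra. }
exists (mkposreal _ HMp). intros y Hy.
assert (Hy' : Rabs y < / M).
{ change (Rabs (y - 0) < / M) in Hy. now rewrite Rminus_0_r in Hy. }
replace (Rpower (1 - 2 * x * y + y ^ 2) (- lambda)) with (PSeries c y).
- apply PSeries_correct, CV_radius_inside, Hin, Hy'.
- generalize (Hh y Hy'). unfold h. rewrite Rpower_Ropp.
  assert (0 < Rpower (1 - 2 * x * y + y ^ 2) lambda) by apply exp_pos.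
  intro E. apply Rmult_eq_reg_r with (Rpower (1 - 2 * x * y + y ^ 2) lambda); [|lra].
  rewrite E, Rinv_l; lra.
Qed.

(* Main.v *)
Require Import Defs.
From Stdlib Require Import Arith Factorial Reals.
From Coquelicot Require Import Coquelicot.
From Stdlib Require Import ZArith Lra Lia.

(* [Reals] has a finite sum of the same name. *)
Local Notation sigma := Defs.sigma.

(** Put [mu = a + 1] and [w = sigma ^ (- mu)].  Since
    [Q_N = sigma ^ N * w^(N) / w], Taylor's formula for [w (x + y sigma)]
    says that [Q_N / N!] is the coefficient of [y ^ N] in
    [w (x + y sigma) / w x = (1 + 2 x y + sigma y ^ 2) ^ (- mu)].
    With [u = 1 + 2 x y + y ^ 2] the base is [u + x ^ 2 y ^ 2], so the binomial
    series gives
    [sum_n binom (- mu) n * (x y) ^ (2 n) * u ^ (- mu - n)],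
    and [u ^ (- (n + mu))] generates the Gegenbauer polynomials of parameter
    [n + mu] at [- x].  This is the theorem.

    The proof below avoids the double series by comparing recurrences.  The
    function [F = (1 + 2 x y + sigma y ^ 2) ^ (- mu)] satisfies
    [(1 + 2 x y + sigma y ^ 2) F' = - 2 mu (x + sigma y) F], that is, its
    coefficients [s_j] satisfy
    [j s_j + 2 x (j - 1 + mu) s_(j-1) + sigma (j - 2 + 2 mu) s_(j-2) = 0].
    For [Q_N / N!] this recurrence is the equation [sigma w' = - 2 mu x w]
    differentiated repeatedly ([polyP_recurrence]).  For the sum over [n] it
    follows from two relations between the Gegenbauer polynomials of parameters
    [lambda] and [lambda + 1], namely [u * u ^ (- lambda - 1) = u ^ (- lambda)]
    and [(u ^ (- lambda))' = - lambda u' * u ^ (- lambda - 1)], by telescoping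
    in [n] ([binomial_sum_recurrence]).  Both sides start with the value [1]. *)

(** * Functions with a power series expansion near 0 *)

Definition expands (f : nat -> R) (F : R -> R) : Prop :=
  locally 0 (fun y => is_pseries f y (F y)).

(** A series converging on a whole neighbourhood of [0] converges at some point
    other than [0], which bounds the radius of convergence from below. *)
Lemma expands_radius (f : nat -> R) (F : R -> R) :
  expands f F -> Rbar_lt 0 (CV_radius f).
Proof.
intros [eps H].
assert (He := cond_pos eps).
assert (Hy : is_pseries f (eps / 2) (F (eps / 2))).
{ apply H. change (Rabs (eps / 2 - 0) < eps). rewrite Rabs_pos_eq; lra. }
destruct (Rbar_lt_le_dec 0 (CV_radius f)) as [Hlt|Hle]; [exact Hlt|].
exfalso. apply (CV_disk_outside f (eps / 2)).
- apply Rbar_le_lt_trans with 0; [exact Hle|].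
  simpl. rewrite Rabs_pos_eq; lra.
- apply ex_series_lim_0. exists (F (eps / 2)). now apply is_pseries_R.
Qed.

Lemma expands_unique (f g : nat -> R) (F : R -> R) (n : nat) :
  expands f F -> expands g F -> f n = g n.
Proof.
intros Hf Hg.
apply PSeries_ext_recip;
  [exact (expands_radius f F Hf)|exact (expands_radius g F Hg)|].
generalize (filter_and _ _ Hf Hg). apply filter_imp. intros y [H1 H2].
now rewrite (is_pseries_unique _ _ _ H1), (is_pseries_unique _ _ _ H2).
Qed.

Lemma expands_ext_loc (f : nat -> R) (F G : R -> R) :
  locally 0 (fun y => F y = G y) -> expands f F -> expands f G.
Proof.
unfold expands. intros HE Hf. generalize (filter_and _ _ HE Hf).
apply filter_imp. intros y [E H]. now rewrite <- E.
Qed.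

Lemma expands_plus (f g : nat -> R) (F G : R -> R) :
  expands f F -> expands g G ->
  expands (fun n => f n + g n) (fun y => F y + G y).
Proof.
unfold expands. intros Hf Hg. generalize (filter_and _ _ Hf Hg). apply filter_imp.
intros y [H1 H2]. exact (is_pseries_plus _ _ _ _ _ H1 H2).
Qed.

Lemma expands_scal (k : R) (f : nat -> R) (F : R -> R) :
  expands f F -> expands (fun n => k * f n) (fun y => k * F y).
Proof.
unfold expands. apply filter_imp. intros y H.
exact (is_pseries_scal k f y (F y) (Rmult_comm _ _) H).
Qed.

Definition shift (f : nat -> R) (n : nat) : R :=
  match n with O => 0 | S m => f m end.

Lemma expands_shift (f : nat -> R) (F : R -> R) :
  expands f F -> expands (shift f) (fun y => y * F y).
Proof.
unfold expands. apply filter_imp. intros y H.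
apply (is_pseries_ext (PS_incr_1 f)); [now intros [|n]|].
exact (is_pseries_incr_1 f y (F y) H).
Qed.

Lemma expands_derive (f : nat -> R) (F F' : R -> R) :
  locally 0 (fun y => is_derive F y (F' y)) ->
  expands f F -> expands (PS_derive f) F'.
Proof.
intros HD Hf.
assert (Hr := expands_radius f F Hf).
assert (Hin : locally 0 (fun y => Rbar_lt (Rabs y) (CV_radius f))).
{ destruct (CV_radius f) as [r| |]; simpl in Hr.
  - exists (mkposreal r Hr). intros y Hy.
    change (Rabs (y - 0) < r) in Hy. now rewrite Rminus_0_r in Hy.
  - now apply filter_forall.
  - easy. }
generalize (filter_and _ _ (filter_and _ _ HD Hin)
                           (locally_locally _ _ Hf)).
unfold expands. apply filter_imp. intros y [[H1 H2] H3].
replace (F' y) with (Derive (PSeries f) y); [now apply is_pseries_derive|].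
apply is_derive_unique.
apply (is_derive_ext_loc F); [|exact H1].
revert H3. apply filter_imp. intros t Ht. symmetry.
now apply is_pseries_unique.
Qed.

(** * Relations between Gegenbauer polynomials of consecutive parameters *)

Section Gegenbauer.

Variables (C : R -> nat -> R -> R).
Hypothesis hC : forall lambda : R, is_gegenbauer lambda (C lambda).

Lemma gegenbauer_base_pos (z : R) :
  locally 0 (fun y => 0 < 1 - 2 * z * y + y ^ 2).
Proof.
assert (Hc : continuous (fun y => 1 - 2 * z * y + y ^ 2) 0).
{ apply (@ex_derive_continuous _ R_NormedModule). now auto_derive. }
apply (Hc (fun v => 0 < v)).
apply open_gt. lra.
Qed.

Lemma gegenbauer_0 (lambda z : R) : C lambda 0 z = 1.
Proof.
assert (H := locally_singleton _ _ (hC lambda z)). simpl in H.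
apply is_pseries_unique in H. rewrite PSeries_0 in H. rewrite H.
replace (1 - 2 * z * 0 + 0 * (0 * 1)) with 1 by ring.
unfold Rpower. now rewrite ln_1, Rmult_0_r, exp_0.
Qed.

Lemma Rpower_opp_succ (u lambda : R) :
  0 < u -> u * Rpower u (- (lambda + 1)) = Rpower u (- lambda).
Proof.
intro Hu. rewrite <- (Rpower_1 u Hu) at 1. rewrite <- Rpower_plus.
f_equal. ring.
Qed.

(** Coefficients of [u * u ^ (- lambda - 1) = u ^ (- lambda)]. *)
Lemma gegenbauer_contiguous (lambda z : R) (n : nat) :
  let B := fun l => C (lambda + 1) l z in
  C lambda n z = B n - 2 * z * shift B n + shift (shift B) n.
Proof.
intro B.
assert (HB : expands B
  (fun y => Rpower (1 - 2 * z * y + y ^ 2) (- (lambda + 1)))) by apply hC.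
assert (H1 := expands_shift _ _ HB).
assert (H2 := expands_shift _ _ H1).
assert (H := expands_plus _ _ _ _
  (expands_plus _ _ _ _ HB (expands_scal (- 2 * z) _ _ H1)) H2).
apply expands_ext_loc
  with (G := fun y => Rpower (1 - 2 * z * y + y ^ 2) (- lambda)) in H.
- rewrite (expands_unique (fun l => C lambda l z) _ _ n (hC lambda z) H).
  ring.
- generalize (gegenbauer_base_pos z). apply filter_imp. intros y Hy.
  rewrite <- (Rpower_opp_succ _ lambda Hy). ring.
Qed.

(** Coefficients of [(u ^ (- lambda))' = - lambda u' * u ^ (- lambda - 1)]. *)
Lemma gegenbauer_derive_y (lambda z : R) (n : nat) :
  let B := fun l => C (lambda + 1) l z in
  INR (S n) * C lambda (S n) z = 2 * lambda * (z * B n - shift B n).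
Proof.
intro B.
assert (HB : expands B
  (fun y => Rpower (1 - 2 * z * y + y ^ 2) (- (lambda + 1)))) by apply hC.
assert (H1 := expands_shift _ _ HB).
assert (H := expands_plus _ _ _ _
  (expands_scal (2 * lambda * z) _ _ HB) (expands_scal (- 2 * lambda) _ _ H1)).
assert (HD : locally 0 (fun y =>
  is_derive (fun y => Rpower (1 - 2 * z * y + y ^ 2) (- lambda)) y
    (2 * lambda * z * Rpower (1 - 2 * z * y + y ^ 2) (- (lambda + 1))
     + - 2 * lambda
       * (y * Rpower (1 - 2 * z * y + y ^ 2) (- (lambda + 1)))))).
{ generalize (gegenbauer_base_pos z). apply filter_imp. intros y Hy.
  evar_last.
  - unfold Rpower. auto_derive; [exact Hy|reflexivity].
  - assert (E := Rpower_opp_succ _ lambda Hy). unfold Rpower in *.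
    simpl in *. change (1 + - (2 * z * y) + y * (y * 1))
      with (1 - 2 * z * y + y * (y * 1)).
    rewrite <- E. field. lra. }
change (INR (S n) * C lambda (S n) z)
  with (PS_derive (fun l => C lambda l z) n).
rewrite (expands_unique _ _ _ n
  (expands_derive _ _ _ HD (hC lambda z)) H).
simpl. ring.
Qed.

End Gegenbauer.

(** Extending a sequence by zero to negative indices lets the two relations
    hold at every integer, with no boundary cases. *)
Definition pad (f : nat -> R) (j : Z) : R :=
  if (j <? 0)%Z then 0 else f (Z.to_nat j).

Lemma pad_neg (f : nat -> R) (j : Z) : (j < 0)%Z -> pad f j = 0.
Proof. intro H. unfold pad. now rewrite (proj2 (Z.ltb_lt j 0) H). Qed.

Lemma pad_nat (f : nat -> R) (n : nat) : pad f (Z.of_nat n) = f n.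
Proof.
unfold pad. rewrite (proj2 (Z.ltb_ge _ 0)) by lia. now rewrite Nat2Z.id.
Qed.

Lemma pad_shift (f : nat -> R) (j : Z) : pad (shift f) j = pad f (j - 1).
Proof.
destruct (Z.lt_ge_cases j 0) as [Hj|Hj]; [rewrite !pad_neg; auto; lia|].
rewrite <- (Z2Nat.id j Hj). rewrite pad_nat.
destruct (Z.to_nat j) as [|n]; [reflexivity|].
replace (Z.of_nat (S n) - 1)%Z with (Z.of_nat n) by lia.
now rewrite pad_nat.
Qed.

Section PaddedGegenbauer.

Variables (C : R -> nat -> R -> R).
Hypothesis hC : forall lambda : R, is_gegenbauer lambda (C lambda).
Variables (lambda z : R).

Let A := pad (fun l => C lambda l z).
Let B := pad (fun l => C (lambda + 1) l z).

Lemma pad_gegenbauer_contiguous (j : Z) :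
  A j = B j - 2 * z * B (j - 1)%Z + B (j - 2)%Z.
Proof.
unfold A, B.
destruct (Z.lt_ge_cases j 0) as [Hj|Hj]; [rewrite !pad_neg by lia; ring|].
replace (j - 2)%Z with (j - 1 - 1)%Z by lia.
rewrite <- !pad_shift, <- (Z2Nat.id j Hj), !pad_nat.
apply (gegenbauer_contiguous C hC).
Qed.

Lemma pad_gegenbauer_derive_y (j : Z) :
  IZR j * A j = 2 * lambda * (z * B (j - 1)%Z - B (j - 2)%Z).
Proof.
unfold A, B.
destruct (Z.le_gt_cases j 0) as [Hj|Hj].
- rewrite !(pad_neg (fun l => C (lambda + 1) l z)) by lia.
  destruct (Z.eq_dec j 0) as [->|Hn]; [ring|].
  rewrite pad_neg by lia. ring.
- replace (j - 2)%Z with (j - 1 - 1)%Z by lia.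
  rewrite <- (pad_shift _ (j - 1)).
  replace j with (Z.of_nat (S (Z.to_nat (j - 1)))) at 1 2 by lia.
  rewrite <- (Z2Nat.id (j - 1)) at 3 4 by lia.
  rewrite !pad_nat, <- INR_IZR_INZ. apply (gegenbauer_derive_y C hC).
Qed.

End PaddedGegenbauer.

(** * The recurrence for the binomial sum *)

Lemma gbinomS (c : R) (n : nat) :
  (INR n + 1) * gbinom c (S n) = gbinom c n * (c - INR n).
Proof.
unfold gbinom. simpl falling. rewrite fact_simpl, mult_INR, S_INR.
generalize (INR_fact_neq_0 n) (pos_INR n); intros. field. lra.
Qed.

Section BinomialSum.

Variables (mu x : R) (g : nat -> Z -> R).

(* [g n] stands for the coefficients of [u ^ (- (n + mu))]. *)
Hypothesis g_contiguous : forall n j,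
  g n j = g (S n) j + 2 * x * g (S n) (j - 1)%Z + g (S n) (j - 2)%Z.
Hypothesis g_derive : forall n j,
  IZR j * g n j
  = - 2 * (INR n + mu) * (x * g (S n) (j - 1)%Z + g (S n) (j - 2)%Z).

Let b := gbinom (- mu).

Definition binomial_sum (M : nat) (j : Z) : R :=
  sum_f_R0 (fun n => b n * x ^ (2 * n) * g n (j - 2 * Z.of_nat n)%Z) M.

(** [mu] times the coefficients of
    [(u + x ^ 2 y ^ 2) ^ (- mu - 1)], expanded as the binomial sum is. *)
Definition binomial_sum_succ (M : nat) (j : Z) : R :=
  sum_f_R0 (fun n => b n * (INR n + mu) * x ^ (2 * n)
                     * g (S n) (j - 2 * Z.of_nat n)%Z) M.

(** What the truncation of the sums at [M] costs; it vanishes for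
    [j < 2 M + 2] as soon as the [g n] vanish at negative indices. *)
Definition truncation_error (M : nat) (j : Z) : R :=
  b M * (INR M + mu) * x ^ (2 * M + 2) * g (S M) (j - 2 * Z.of_nat M - 2)%Z.

(** Coefficients of [F' = - (2 x + 2 sigma y) * mu (u + x ^ 2 y ^ 2) ^ (- mu - 1)].
    Differentiating [u ^ (- mu - n)] produces [u' = 2 x + 2 y]; differentiating
    [y ^ (2 n)] lowers [n], and [(n + 1) b_(n+1) = - (mu + n) b_n] turns this part
    into the missing [2 x ^ 2 y]. *)
Lemma binomial_sum_derive (M : nat) (j : Z) :
  IZR j * binomial_sum M j
  = - (2 * x * binomial_sum_succ M (j - 1)
       + 2 * sigma x * binomial_sum_succ M (j - 2)) + 2 * truncation_error M j.
Proof.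
unfold sigma.
induction M as [|M IH].
- unfold binomial_sum, binomial_sum_succ, truncation_error. simpl sum_f_R0.
  generalize (g_derive 0 j). simpl Z.of_nat. simpl Z.mul.
  rewrite !Z.sub_0_r. unfold b, gbinom. simpl. intro H.
  replace (IZR j * (1 / 1 * 1 * g 0%nat j)) with (IZR j * g 0%nat j) by field.
  rewrite H. field.
- unfold binomial_sum, binomial_sum_succ in *. rewrite !tech5.
  rewrite Rmult_plus_distr_l, IH. unfold truncation_error.
  assert (Hb : (INR M + 1) * b (S M) = b M * (- mu - INR M)) by apply gbinomS.
  set (k := (j - 2 * Z.of_nat (S M))%Z).
  replace (j - 1 - 2 * Z.of_nat (S M))%Z with (k - 1)%Z by lia.
  replace (j - 2 - 2 * Z.of_nat (S M))%Z with (k - 2)%Z by lia.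
  replace (j - 2 * Z.of_nat M - 2)%Z with k by lia.
  assert (Hk : IZR j = IZR k + 2 * (INR M + 1)).
  { unfold k. rewrite minus_IZR, mult_IZR, <- INR_IZR_INZ, S_INR. ring. }
  assert (Hg := g_derive (S M) k).
  replace (2 * M + 2)%nat with (2 * S M)%nat by lia.
  rewrite pow_add. rewrite Hk.
  replace ((IZR k + 2 * (INR M + 1)) * (b (S M) * x ^ (2 * S M) * g (S M) k))
    with (b (S M) * x ^ (2 * S M) * (IZR k * g (S M) k)
          + 2 * ((INR M + 1) * b (S M)) * x ^ (2 * S M) * g (S M) k) by ring.
  rewrite Hg, Hb. ring.
Qed.

(** Coefficients of
    [(u + x ^ 2 y ^ 2) * mu (u + x ^ 2 y ^ 2) ^ (- mu - 1) = mu F]: multiplying by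
    [x ^ 2 y ^ 2] raises [n], and what it adds to the [n]-th term is
    [(n - 1 + mu) b_(n-1) = - n b_n], which reduces [(n + mu) b_n] to [mu b_n]. *)
Lemma binomial_sum_base (M : nat) (j : Z) :
  binomial_sum_succ M j + 2 * x * binomial_sum_succ M (j - 1)
  + sigma x * binomial_sum_succ M (j - 2)
  = mu * binomial_sum M j + truncation_error M j.
Proof.
unfold sigma.
induction M as [|M IH].
- unfold binomial_sum, binomial_sum_succ, truncation_error. simpl sum_f_R0.
  generalize (g_contiguous 0 j). simpl Z.of_nat. simpl Z.mul.
  rewrite !Z.sub_0_r. unfold b, gbinom. simpl. intros ->. field.
- unfold binomial_sum, binomial_sum_succ in *. rewrite !tech5.
  revert IH. unfold truncation_error.
  assert (Hb : (INR M + 1) * b (S M) = b M * (- mu - INR M)) by apply gbinomS.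
  set (k := (j - 2 * Z.of_nat (S M))%Z).
  replace (j - 1 - 2 * Z.of_nat (S M))%Z with (k - 1)%Z by lia.
  replace (j - 2 - 2 * Z.of_nat (S M))%Z with (k - 2)%Z by lia.
  replace (j - 2 * Z.of_nat M - 2)%Z with k by lia.
  replace (b M * (INR M + mu)) with (- ((INR M + 1) * b (S M)))
    by (rewrite Hb; ring).
  replace (2 * M + 2)%nat with (2 * S M)%nat by lia.
  rewrite (pow_add x (2 * S M) 2), S_INR, (g_contiguous (S M) k).
  lra.
Qed.

(** Eliminating [(u + x ^ 2 y ^ 2) ^ (- mu - 1)] from the two previous relations. *)
Lemma binomial_sum_recurrence (M : nat) (j : Z) :
  (forall n i, (i < 0)%Z -> g n i = 0) ->
  (j < 2 * Z.of_nat M + 2)%Z ->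
  IZR j * binomial_sum M j
  + 2 * x * (IZR j - 1 + mu) * binomial_sum M (j - 1)
  + sigma x * (IZR j - 2 + 2 * mu) * binomial_sum M (j - 2) = 0.
Proof.
intros Hneg Hj.
assert (Hr : forall i, (i <= j)%Z -> truncation_error M i = 0).
{ intros i Hi. unfold truncation_error. rewrite Hneg by lia. ring. }
assert (D0 := binomial_sum_derive M j).
assert (D1 := binomial_sum_derive M (j - 1)).
assert (D2 := binomial_sum_derive M (j - 2)).
assert (B1 := binomial_sum_base M (j - 1)).
assert (B2 := binomial_sum_base M (j - 2)).
rewrite Hr in D0, D1, D2, B1, B2 by lia.
rewrite minus_IZR in D1, D2.
replace (j - 1 - 1)%Z with (j - 2)%Z in * by lia.
replace (j - 2 - 1)%Z with (j - 1 - 2)%Z in * by lia.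
replace (IZR j * binomial_sum M j
  + 2 * x * (IZR j - 1 + mu) * binomial_sum M (j - 1)
  + sigma x * (IZR j - 2 + 2 * mu) * binomial_sum M (j - 2))
  with (IZR j * binomial_sum M j
  + 2 * x * ((IZR j - 1) * binomial_sum M (j - 1)
             + mu * binomial_sum M (j - 1))
  + sigma x * ((IZR j - 2) * binomial_sum M (j - 2)
               + 2 * (mu * binomial_sum M (j - 2)))) by ring.
rewrite D0, D1, D2.
replace (mu * binomial_sum M (j - 1)) with (mu * binomial_sum M (j - 1) + 0)
  by ring.
replace (mu * binomial_sum M (j - 2)) with (mu * binomial_sum M (j - 2) + 0)
  by ring.
rewrite <- B1, <- B2. ring.
Qed.

End BinomialSum.

(** * The recurrence for the Romanovski polynomials *)

Section Romanovski.

Variable a : R.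
Let mu := a + 1.
Let w := weight a 0 0.

Lemma is_derive_weight (x : R) : is_derive w x (- 2 * mu * x * w x / sigma x).
Proof.
assert (Hs := sigma_gt0 x).
apply (is_derive_ext (fun t => Rpower (sigma t) (- mu))).
- intro t. unfold w, weight, mu. simpl INR.
  rewrite Ropp_0, Rmult_0_l, exp_0, Rmult_1_r. f_equal. ring.
- replace (w x) with (Rpower (sigma x) (- mu)).
  + unfold Rpower, sigma in *. evar_last; [auto_derive; [exact Hs|reflexivity]|].
    simpl in *. field. lra.
  + unfold w, weight, mu. simpl INR.
    rewrite Ropp_0, Rmult_0_l, exp_0, Rmult_1_r. f_equal. ring.
Qed.

(** [sigma w' = - 2 mu x w], differentiated [n + 1] times.  Smoothness of [w] is
    obtained along the way: the equation expresses each derivative by the two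
    before it. *)
Lemma Derive_n_weight (n : nat) :
  (forall x, is_derive (Derive_n w n) x (Derive_n w (S n) x)) /\
  (forall x, is_derive (Derive_n w (S n)) x (Derive_n w (S (S n)) x)) /\
  (forall x, sigma x * Derive_n w (S (S n)) x
     = - 2 * x * (INR n + 1 + mu) * Derive_n w (S n) x
       - (INR n + 1) * (INR n + 2 * mu) * Derive_n w n x).
Proof.
induction n as [|n (IH0 & IH1 & IH2)].
- assert (D0 : forall x, is_derive (Derive_n w 0) x (Derive_n w 1 x)).
  { intro x. apply Derive_correct. eexists. apply is_derive_weight. }
  assert (E1 : forall x, - 2 * mu * x * w x / sigma x = Derive_n w 1 x).
  { intro x. symmetry. apply is_derive_unique, is_derive_weight. }
  assert (D1 : forall x, is_derive (Derive_n w 1) x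
    (- 2 * mu * (w x + x * Derive_n w 1 x) / sigma x
     - 2 * x * (- 2 * mu * x * w x / sigma x) / sigma x)).
  { intro x. apply (is_derive_ext _ _ _ _ E1).
    assert (Hs := sigma_gt0 x). unfold sigma in *. evar_last.
    - auto_derive; [|reflexivity]. split; [|split; [lra|easy]].
      eexists. apply (D0 x).
    - rewrite (is_derive_unique _ _ _ (D0 x)
                 : Derive (fun t => w t) x = _).
      field. simpl in Hs. lra. }
  split; [exact D0|split].
  + intro x. apply Derive_correct. eexists. apply D1.
  + intro x. change (Derive_n w 2 x) with (Derive (Derive_n w 1) x).
    rewrite (is_derive_unique _ _ _ (D1 x)), <- E1.
    assert (Hs := sigma_gt0 x). simpl. field. lra.
- assert (E : forall x,
    (- 2 * x * (INR n + 1 + mu) * Derive_n w (S n) x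
       - (INR n + 1) * (INR n + 2 * mu) * Derive_n w n x) / sigma x
    = Derive_n w (S (S n)) x).
  { intro x. rewrite <- IH2. generalize (sigma_gt0 x). intro. field. lra. }
  assert (D : forall x, is_derive (Derive_n w (S (S n))) x
    ((- 2 * (INR n + 1 + mu) * (Derive_n w (S n) x + x * Derive_n w (S (S n)) x)
      - (INR n + 1) * (INR n + 2 * mu) * Derive_n w (S n) x) / sigma x
     - 2 * x * Derive_n w (S (S n)) x / sigma x)).
  { intro x. apply (is_derive_ext _ _ _ _ E). rewrite <- (E x).
    assert (Hs := sigma_gt0 x).
    set (f1 := Derive_n w (S n)) in *. set (f0 := Derive_n w n) in *.
    unfold sigma in *. evar_last.
    - auto_derive; [|reflexivity].
      split; [eexists; apply (IH1 x)|].
      split; [eexists; apply (IH0 x)|]. split; [lra|easy].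
    - rewrite (is_derive_unique _ _ _ (IH0 x) : Derive (fun t => f0 t) x = _).
      rewrite (is_derive_unique _ _ _ (IH1 x) : Derive (fun t => f1 t) x = _).
      rewrite <- E. fold f0 f1. unfold sigma. field. simpl in Hs. lra. }
  split; [exact IH1|split].
  + intro x. apply Derive_correct. eexists. apply D.
  + intro x. change (Derive_n w (S (S (S n))) x)
      with (Derive (Derive_n w (S (S n))) x).
    rewrite (is_derive_unique _ _ _ (D x)), S_INR.
    assert (Hs := sigma_gt0 x). field. lra.
Qed.

Lemma polyP_0 (x : R) : polyP a 0 0 x = 1.
Proof. apply (proj1 (is_romanovski_exists a 0)). Qed.

Lemma polyP_1 (x : R) : polyP a 0 1 x = - 2 * mu * x.
Proof.
rewrite polyPE. change (Derive_n (weight a 0 0) 1 x) with (Derive w x).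
rewrite (is_derive_unique _ _ _ (is_derive_weight x)).
generalize (weight_gt0 a 0 0 x) (sigma_gt0 x). unfold w. intros.
field. lra.
Qed.

Lemma polyP_recurrence (n : nat) (x : R) :
  polyP a 0 (S (S n)) x
  = - 2 * x * (INR n + 1 + mu) * polyP a 0 (S n) x
    - (INR n + 1) * (INR n + 2 * mu) * sigma x * polyP a 0 n x.
Proof.
rewrite !polyPE. fold w.
generalize (weight_gt0 a 0 0 x) (sigma_gt0 x). fold w. intros Hw Hs.
replace (sigma x ^ S (S n) / w x * Derive_n w (S (S n)) x)
  with (sigma x ^ S n / w x * (sigma x * Derive_n w (S (S n)) x))
  by (rewrite <- (tech_pow_Rmult _ (S n)); field; lra).
rewrite (proj2 (proj2 (Derive_n_weight n))).
rewrite <- tech_pow_Rmult. field. lra.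
Qed.

End Romanovski.

(** * Comparison of the two recurrences *)

Theorem theorem4p2
  (a : R)
  (Q : nat -> R -> R) (hQ : is_romanovski a 0 Q)
  (C : R -> nat -> R -> R)
  (hC : forall lambda : R, is_gegenbauer lambda (C lambda))
  (N : nat) (x : R) :
  Q N x =
  (INR (fact N) *
   sum_f_R0
     (fun n =>
        gbinom (- a - 1) n * x ^ (2 * n)
        * C (INR n + a + 1) (N - 2 * n)%nat (- x))
     (N / 2))%R.
Proof.
rewrite (is_romanovski_unique a 0 Q hQ).
set (M := (N / 2)%nat).
assert (HM : (2 * M <= N < 2 * M + 2)%nat).
{ generalize (Nat.div_mod_eq N 2) (Nat.mod_upper_bound N 2). fold M. lia. }
set (g := fun n => pad (fun l => C (INR n + (a + 1)) l (- x))).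
assert (Hneg : forall n i, (i < 0)%Z -> g n i = 0).
{ intros n i. apply pad_neg. }
assert (HgS : forall n,
  g (S n) = pad (fun l => C (INR n + (a + 1) + 1) l (- x))).
{ intro n. unfold g. rewrite S_INR.
  now replace (INR n + 1 + (a + 1)) with (INR n + (a + 1) + 1) by ring. }
set (s := binomial_sum (a + 1) x g M).
assert (Hs : forall j, (j < 2 * Z.of_nat M + 2)%Z ->
  IZR j * s j + 2 * x * (IZR j - 1 + (a + 1)) * s (j - 1)%Z
  + sigma x * (IZR j - 2 + 2 * (a + 1)) * s (j - 2)%Z = 0).
{ intros j Hj. apply binomial_sum_recurrence; [| |exact Hneg|exact Hj].
  - intros n i. rewrite HgS. unfold g at 1.
    rewrite (pad_gegenbauer_contiguous C hC). ring.
  - intros n i. rewrite HgS. unfold g at 1.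
    rewrite (pad_gegenbauer_derive_y C hC). ring. }
assert (Hs0 : s 0%Z = 1).
{ unfold s, binomial_sum.
  assert (H : forall m,
    sum_f_R0 (fun n => gbinom (- (a + 1)) n * x ^ (2 * n)
                       * g n (0 - 2 * Z.of_nat n)%Z) m = 1).
  { induction m as [|m IH].
    - simpl sum_f_R0. unfold g, pad. simpl.
      rewrite (gegenbauer_0 C hC). unfold gbinom. simpl. field.
    - rewrite tech5, IH, Hneg by lia. ring. }
  apply H. }
assert (Hsneg : s (- 1)%Z = 0).
{ unfold s, binomial_sum. apply sum_eq_R0. intros n _. rewrite Hneg by lia. ring. }
assert (Hall : forall k, (k <= N)%nat ->
  polyP a 0 k x = INR (fact k) * s (Z.of_nat k)).
{ cut (forall k, ((k <= N)%nat ->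
      polyP a 0 k x = INR (fact k) * s (Z.of_nat k)) /\
    ((S k <= N)%nat ->
      polyP a 0 (S k) x = INR (fact (S k)) * s (Z.of_nat (S k)))).
  { intros H k. apply H. }
  induction k as [|k [IH0 IH1]].
  - split; intro Hk.
    + rewrite polyP_0. simpl Z.of_nat. rewrite Hs0. simpl. ring.
    + rewrite polyP_1. assert (H := Hs 1%Z ltac:(lia)).
      simpl Z.sub in H. rewrite Hs0, Hsneg in H. simpl. lra.
  - split; [exact IH1|]. intro Hk.
    rewrite polyP_recurrence, IH0, IH1 by lia.
    assert (H := Hs (Z.of_nat (S (S k))) ltac:(lia)).
    replace (Z.of_nat (S (S k)) - 1)%Z with (Z.of_nat (S k)) in H by lia.
    replace (Z.of_nat (S (S k)) - 2)%Z with (Z.of_nat k) in H by lia.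
    rewrite <- INR_IZR_INZ in H.
    rewrite (fact_simpl (S k)), (fact_simpl k), !mult_INR.
    rewrite !S_INR in *.
    replace ((INR k + 1 + 1) * ((INR k + 1) * INR (fact k)) * s (Z.of_nat (S (S k))))
      with ((INR k + 1) * INR (fact k)
            * ((INR k + 1 + 1) * s (Z.of_nat (S (S k))))) by ring.
    replace ((INR k + 1 + 1) * s (Z.of_nat (S (S k))))
      with (- (2 * x * (INR k + 1 + 1 - 1 + (a + 1)) * s (Z.of_nat (S k))
        + sigma x * (INR k + 1 + 1 - 2 + 2 * (a + 1)) * s (Z.of_nat k))) by lra.
    ring. }
rewrite Hall by lia. f_equal.
apply sum_eq. intros n Hn. unfold g.
replace (Z.of_nat N - 2 * Z.of_nat n)%Z with (Z.of_nat (N - 2 * n)) by lia.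
rewrite pad_nat.
replace (- (a + 1)) with (- a - 1) by ring.
now replace (INR n + (a + 1)) with (INR n + a + 1) by ring.
Qed.
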